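(* Let $k\ge 1$, $\ell\ge 0$, $\beta\ge 1$, $n\ge 1$ be integers, and let $s_1,\dots,s_k,\alpha_1,\dots,\alpha_\ell$ be integers with $1\le s_1<\dots<s_k\le\lfloor \beta n/2\rfloor$ and $1\le\alpha_1<\dots<\alpha_\ell\le\lfloor\beta/2\rfloor$. Let $\tau(n)$ be the number of spanning trees of the circulant graph $C_{\beta n}(s_1,\dots,s_k,\alpha_1 n,\dots,\alpha_\ell n)$. For each $u=0,1,\dots,\beta-1$ let $w_1(u),\dots,w_{s_k}(u)$ be all the complex roots, listed with multiplicity, of the degree-$s_k$ equation $$\sum_{i=1}^k T_{s_i}(w)=k+2\sum_{m=1}^{\ell}\sin^2\!\left(\frac{\pi u\alpha_m}{\beta}\right),$$ and put $q=s_1^2+s_2^2+\dots+s_k^2$. Then $$\tau(n)=\frac{n}{\beta q}\;\prod_{\substack{1\le j\le s_k\\ w_j(0)\ne 1}}\left|2T_n(w_j(0))-2\right|\;\cdot\;\prod_{u=1}^{\beta-1}\prod_{j=1}^{s_k}\left|2T_n(w_j(u))-2\cos\!\left(\frac{2\pi u}{\beta}\right)\right|.$$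
   Context: $T_s(w)$ denotes the Chebyshev polynomial of the first kind ($T_s(\cos\varphi)=\cos(s\varphi)$). For integers $1\le c_1,\dots,c_r\le N/2$, the circulant graph $C_N(c_1,\dots,c_r)$ is the loopless multigraph on vertices $0,1,\dots,N-1$ in which each vertex $i$ is joined to $i\pm c_1,\dots,i\pm c_r \pmod N$, counted with multiplicity: the number of edges between distinct vertices $x$ and $y$ is the number of pairs $(j,\epsilon)$, $1\le j\le r$, $\epsilon\in\{+1,-1\}$, with $y\equiv x+\epsilon c_j \pmod N$. Thus every vertex has degree $2r$; in particular a jump $c_j=N/2$ produces double edges between opposite vertices, and coinciding jumps produce multiple edges. Equivalently, the Laplacian matrix is $2rI_N-\sum_{j=1}^r(T^{c_j}+T^{-c_j})$ where $T$ is the $N\times N$ cyclic shift permutation matrix. Spanning trees are counted with parallel edges regarded as distinct. Empty sums are $0$ and empty products are $1$; $\ell=0$ means there are no jumps $\alpha_m n$. *)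

(* Defs.v *)
From HB Require Import structures.
From mathcomp Require Import all_boot all_order all_algebra.
From mathcomp Require Import boolp reals trigo.
From mathcomp Require Import complex ring.

Set Implicit Arguments.
Unset Strict Implicit.
Unset Printing Implicit Defensive.

Import Order.TTheory GRing.Theory Num.Theory.

(* Edges are individual objects, so parallel edges are distinct. The order of
   the two endpoints recorded by [ends] is irrelevant: see [joins]. *)
Record multigraph := Multigraph {
  vertex : finType;
  edge : finType;
  ends : edge -> vertex * vertex
}.

Section SpanningTrees.
Variable G : multigraph.
Implicit Types (x y : vertex G) (e : edge G) (A : {set edge G}).
Implicit Type p : seq (edge G * vertex G).

Definition joins e x y : bool := (ends e == (x, y)) || (ends e == (y, x)).

Definition adjacent A x y : bool := [exists e in A, joins e x y].

Definition connected_by A : Prop := forall x y, connect (adjacent A) x y.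

(* The walk x, e_1, y_1, ..., e_m, y_m is coded by its origin x and the list
   of the pairs (e_i, y_i). *)
Fixpoint walk x p : bool :=
  if p is (e, y) :: p' then joins e x y && walk y p' else true.

(* A closed walk of positive length without repeated edge, and without
   repeated vertex except that it ends at its origin. *)
Definition is_cycle A x p : bool :=
  [&& p != [::], walk x p, last x (unzip2 p) == x,
      uniq (unzip1 p), uniq (unzip2 p) & all [in A] (unzip1 p)].

Definition acyclic A : Prop := forall x p, ~~ is_cycle A x p.

Definition spanning_tree A : Prop := connected_by A /\ acyclic A.

Definition num_spanning_trees : nat :=
  #|[set A : {set edge G} | `[< spanning_tree A >]]|.

End SpanningTrees.

Section Circulant.
Variables (N : nat) (c : seq nat).

(* y = x + eps c_j modulo N, with eps = +1 for [true] and -1 for [false] *)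
Definition jump_to (x y : 'I_N) (je : 'I_(size c) * bool) : bool :=
  if je.2 then y == x + nth 0 c je.1 %[mod N]
  else y + nth 0 c je.1 == x %[mod N].

(* One edge {x, y}, oriented so that x < y, for each (j, eps) such that
   y = x + eps c_j modulo N. *)
Definition circulant_edge : finType :=
  {e : 'I_N * 'I_N * ('I_(size c) * bool)
     | (e.1.1 < e.1.2) && jump_to e.1.1 e.1.2 e.2}.

Definition circulant : multigraph :=
  @Multigraph 'I_N circulant_edge (fun e => (val e).1).

Lemma jump_toC x y j b : jump_to x y (j, b) = jump_to y x (j, ~~ b).
Proof. by case: b; rewrite /jump_to /= eq_sym. Qed.

Lemma card_joins_circulant (x y : 'I_N) : x != y ->
  #|[set e : edge circulant | joins e x y]| = #|[set je | jump_to x y je]|.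
Proof.
wlog ltxy : x y / x < y.
  move=> IH nxy; case: (ltngtP x y) => [lt|lt|/val_inj/eqP]; first exact: IH.
    rewrite -[LHS](_ : #|[set e : edge circulant | joins e y x]| = _); last first.
      by apply: eq_card => e; rewrite !inE /joins orbC.
    rewrite IH 1?eq_sym //.
    have flipK : involutive (fun je : 'I_(size c) * bool => (je.1, ~~ je.2)).
      by case=> j b /=; rewrite negbK.
    rewrite -(card_imset _ (inv_inj flipK)); apply: eq_card => -[j b].
    rewrite !inE jump_toC; apply/imsetP/idP => [[[j' b']]|h].
      by rewrite inE => h [-> ->]; rewrite negbK.
    by exists (j, ~~ b); rewrite ?inE //= negbK.
  by rewrite (negPf nxy).
move=> _.
have inj : {in [set e : edge circulant | joins e x y] &,
    injective (fun e : edge circulant => (val e).2)}.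
  have E (e : edge circulant) : joins e x y -> (val e).1 = (x, y).
    case/orP=> /eqP //= e1; case/andP: (valP e) => + _.
    by rewrite e1 /= ltnNge (ltnW ltxy).
  move=> e f; rewrite !inE => /E e1 /E f1 ef; apply: val_inj.
  by rewrite [LHS]surjective_pairing [RHS]surjective_pairing ef e1 f1.
rewrite -(card_in_imset inj); apply: eq_card => je; rewrite inE.
apply/imsetP/idP => [[e]|h].
  rewrite inE => /orP[] /eqP /= e1 ->; case/andP: (valP e); rewrite e1 //=.
  by rewrite ltnNge (ltnW ltxy).
have h' : (x < y) && jump_to x y je by rewrite ltxy.
exists (exist _ (x, y, je) h') => //.
by rewrite inE /joins eqxx.
Qed.

End Circulant.

Local Open Scope ring_scope.

Section Chebyshev.
Variable R : comNzRingType.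

(* (T_m, T_(m.+1)) *)
Fixpoint cheb_pair (m : nat) : {poly R} * {poly R} :=
  if m is m'.+1 then
    let: (p, q) := cheb_pair m' in (q, 2 *: ('X * q) - p)
  else (1, 'X).

Definition cheb (m : nat) : {poly R} := (cheb_pair m).1.

Lemma cheb0 : cheb 0 = 1.
Proof. by []. Qed.

Lemma cheb1 : cheb 1 = 'X.
Proof. by []. Qed.

Lemma chebSS m : cheb m.+2 = 2 *: ('X * cheb m.+1) - cheb m.
Proof. by rewrite /cheb /=; case: (cheb_pair m). Qed.

End Chebyshev.

Lemma cheb_cos (R : realType) (m : nat) (phi : R) :
  (cheb R m).[cos phi] = cos (m%:R * phi).
Proof.
suff: (cheb R m).[cos phi] = cos (m%:R * phi) /\
      (cheb R m.+1).[cos phi] = cos (m.+1%:R * phi) by case.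
elim: m => [|m [IH0 IH1]].
  by split; [rewrite cheb0 !hornerE cos0 | rewrite cheb1 !hornerE].
split=> //; rewrite chebSS hornerD hornerN hornerZ hornerM hornerX IH0 IH1.
have -> : m.+2%:R * phi = m.+1%:R * phi + phi by rewrite -natr1 mulrDl mul1r.
have -> : m%:R * phi = m.+1%:R * phi - phi.
  by rewrite -natr1 mulrDl mul1r addrK.
by rewrite cosB cosD; ring.
Qed.

(* [w] lists the roots of [P] in [F], each repeated according to its
   multiplicity. *)
Definition lists_roots (F : fieldType) (P : {poly F}) (d : nat)
    (w : 'I_d -> F) : Prop :=
  forall z : F, #|[set j | w j == z]| = mup z P.

(* Main.v *)
Require Import Defs.
From mathcomp Require Import all_boot all_order all_algebra fingroup perm.
From mathcomp Require Import boolp reals trigo.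
From mathcomp Require Import complex ring lra zify.

Set Implicit Arguments.
Unset Strict Implicit.
Unset Printing Implicit Defensive.

Import Order.TTheory GRing.Theory Num.Theory.

(** Write [N = beta * n] and let [z] be a primitive [N]-th root of unity.

    Counting trees by a determinant. Let [L] be the Laplacian. The row of a
    vertex [x] in [X + L] is the sum, over all the ways of either stopping at
    [x] (the row [X d_x]) or leaving [x] along an edge to a neighbour [y] (the
    row [d_x - d_y]), where [d] is the standard basis. Expanding the determinant
    by rows gives one term for each map [f] that tells every vertex to stop or
    to leave along some edge. The term is [X] to the number of stopping vertices
    if following [f] always leads to a stop, and is 0 if [f] has a cycle. So the
    coefficient of [X] counts the spanning trees with a chosen root, and it is
    [N] times the number of spanning trees ([matrix_tree]).

    Spectrum. The vectors [(z ^ (j x))_x] are eigenvectors of the Laplacian of a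
    circulant graph, and [L] has a zero eigenvalue for [j = 0]. Hence [N] times
    the number of spanning trees is the product of the eigenvalues
    [lambda_j = sum_a (2 - z ^ (j a) - z ^ (- j a))] for [0 < j < N]
    ([num_spanning_trees_circulant]).

    Chebyshev polynomials. Put [x = (z ^ j + z ^ - j) / 2]. Since
    [2 T_m (x) = z ^ (j m) + z ^ (- j m)], and since the terms of [lambda_j] that
    come from the jumps [alpha n] depend on [j] modulo [beta] only, one gets
    [lambda_j = - 2 P_u (x)] where [u = j mod beta] and [P_u] is the polynomial
    whose roots are the [w_i (u)]. As [2 P_u (X)] is the product of the
    [2 X - 2 w_i (u)], each [lambda_j] is up to sign the product over [i] of
    [2 w_i (u) - z ^ j - z ^ - j].

    Regrouping. For a fixed root [w], the product of the
    [2 w - z ^ j - z ^ - j] over the [n] indices [j = u + beta t] is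
    [2 T_n (w) - z ^ (n u) - z ^ (- n u)] ([prod_joukowski]): both sides are
    Laurent polynomials with the same zeros once [w] is written
    [(v + v ^ -1) / 2]. In the class [u = 0] the index [j = 0] is missing. This
    divides the factor of each [w] other than 1 by [2 w - 2], and replaces that
    of [w = 1] by [n ^ 2]. Moreover 1 is a simple root of [P_0], because
    [P_0' (1) = sum_i s_i ^ 2 = q], and comparing the derivatives of both sides
    of [2 P_0 (X) = prod (2 X - 2 w_i)] at 1 shows that the divisors [2 w - 2]
    multiply to [q] up to sign. Taking norms removes all signs. *)

(** * Spanning trees oriented towards a root *)

Section Arborescences.
Variable G : multigraph.
Notation V := (vertex G).
Notation E := (edge G).
Implicit Types (x y z r : V) (e : E) (A : {set E}) (p : seq (E * V)).
Implicit Types (f g : {ffun V -> option (E * V)}) (h : V -> nat).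

Lemma joinsC e x y : joins e x y = joins e y x.
Proof. by rewrite /joins orbC. Qed.

Lemma joins_inj e x y z : joins e x y -> joins e x z -> y = z.
Proof.
rewrite /joins; case: (ends e) => a b; rewrite !xpair_eqE.
by move=> /orP[] /andP[/eqP ? /eqP ?] /orP[] /andP[/eqP ? /eqP ?]; congruence.
Qed.

Lemma joins_ends e x y u v : joins e x y -> joins e u v -> x = u \/ x = v.
Proof.
rewrite /joins; case: (ends e) => a b; rewrite !xpair_eqE.
move=> /orP[] /andP[/eqP ? /eqP ?] /orP[] /andP[/eqP ? /eqP ?];
  by [left; congruence | right; congruence].
Qed.

(** The map [f] sends a vertex either to [None], where it stops, or to an
    incident edge along with its other end, which an unoriented edge does not
    determine by itself. A height that drops along [f] certifies that [f] has no
    cycle; it orients every edge used by [f], which is what the arguments about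
    cycles and uniqueness below rely on. *)
Definition descends f h : Prop :=
  forall x e y, f x = Some (e, y) -> joins e x y /\ h y < h x.

Definition arborescence r f : Prop :=
  [/\ f r = None, forall x, x != r -> f x != None & exists h, descends f h].

Definition arcs f : {set E} := [set e | [exists x, exists y, f x == Some (e, y)]].

Lemma arcsP f e : reflect (exists x y, f x = Some (e, y)) (e \in arcs f).
Proof.
rewrite inE; apply: (iffP existsP) => [[x /existsP[y /eqP]]|[x [y fx]]].
  by exists x, y.
by exists x; apply/existsP; exists y; rewrite fx.
Qed.

Lemma adjacent_sym A : symmetric (adjacent A).
Proof. by move=> x y; apply: eq_existsb => e; rewrite joinsC. Qed.

Lemma arborescence_connected r f : arborescence r f -> connected_by (arcs f).
Proof.
case=> fr fN [h fh].
have toroot n x : h x <= n -> connect (adjacent (arcs f)) x r.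
  elim: n x => [|n IH] x hx; case: (eqVneq x r) => [-> //|xr].
    case fx: (f x) (fN _ xr) => [[e y]|] // _.
    by have [_] := fh _ _ _ fx; move: hx; rewrite leqn0 => /eqP->.
  case fx: (f x) (fN _ xr) => [[e y]|] // _.
  have [exy hy] := fh _ _ _ fx.
  apply: (connect_trans (connect1 _) (IH y _)); last by rewrite -ltnS (leq_trans hy).
  by apply/existsP; exists e; rewrite exy andbT; apply/arcsP; exists x, y.
move=> x y; apply: (connect_trans (toroot _ _ (leqnn _))).
by rewrite (sym_connect_sym (@adjacent_sym _)) (toroot _ _ (leqnn _)).
Qed.

Lemma arc_up_or_down f h e x y : descends f h -> joins e x y -> e \in arcs f ->
  (f x = Some (e, y) /\ h y < h x) \/ (f y = Some (e, x) /\ h x < h y).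
Proof.
move=> fh exy /arcsP[u [v fu]]; have [euv hv] := fh _ _ _ fu.
have [xu|xv] := joins_ends exy euv.
  by subst u; rewrite (joins_inj exy euv); left.
subst v; move: euv; rewrite joinsC => euv.
by rewrite (joins_inj exy euv); right.
Qed.

(** In a walk that repeats no edge, a step away from the root cannot be
    followed by a step towards it: the only edge by which [f] leaves a vertex
    is the one just used to enter it. *)
Lemma walk_down f h x e y p : descends f h -> f x = Some (e, y) ->
  walk x p -> uniq (e :: unzip1 p) -> all [in arcs f] (unzip1 p) ->
  h x <= h (last x (unzip2 p)).
Proof.
move=> fh; elim: p x e y => [|[e' x'] p IH] x e y fx //= /andP[ex' wp].
rewrite inE negb_or -!andbA => /and4P[ee' _ e'p up] /andP[e'A pA].
have [[fx' _]|[fx' lt]] := arc_up_or_down fh ex' e'A.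
  by move: ee'; move: fx'; rewrite fx => -[-> _]; rewrite eqxx.
by apply: leq_trans (ltnW lt) _; apply: IH fx' _ _ _ => //; rewrite /= e'p.
Qed.

(** By [walk_down], a walk that repeats no edge first climbs towards the root
    and then moves away from it. Either it only climbs, or its last edge is the
    one by which [f] leaves its last vertex. *)
Lemma walk_up f h x p : descends f h ->
  walk x p -> uniq (unzip1 p) -> all [in arcs f] (unzip1 p) ->
  h (last x (unzip2 p)) + size p <= h x \/
  exists e y, p != [::] /\ f (last x (unzip2 p)) = Some (last e (unzip1 p), y).
Proof.
move=> fh; elim: p x => [|[e' x'] p IH] x /=; first by left; rewrite addn0.
case/andP=> ex' wp /andP[e'p up] /andP[e'A pA].
have [lt|[e [y [pn fl]]]] := IH x' wp up pA; last first.
  right; exists e', y; split=> //; rewrite fl.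
  by case: (p) pn => // -[].
have [[fx' lt']|[fx' lt']] := arc_up_or_down fh ex' e'A.
  by left; lia.
case: p wp e'p up pA lt {IH} => [|[e1 x1] p] wp e'p up pA lt.
  by right; exists e', x.
have := walk_down fh fx' wp; rewrite cons_uniq e'p up => /(_ isT pA).
by move: lt => /=; lia.
Qed.

(** For a closed walk from [x] both ends are the same vertex. If its last edge
    is the one by which [f] leaves [x], its first edge is a different one, so
    the whole walk moves away from the root and cannot come back to [x]. *)
Lemma descends_acyclic f h : descends f h -> acyclic (arcs f).
Proof.
move=> fh x p; apply/negP=> /and5P[pN wp /eqP lp up /andP[_ pA]].
have [|[e0 [y0 [_]]]] := walk_up fh wp up pA.
  by rewrite lp; case: (p) pN => //= a q _; lia.
rewrite lp; case: p pN wp lp up pA => [|[e y] p] // _ wp lp up pA fx.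
have /= /andP[exy wp'] := wp; have /= /andP[ep up'] := up.
have /= /andP[eA pA'] := pA.
have [[fx' lt]|[fy lt]] := arc_up_or_down fh exy eA.
  move: fx; rewrite fx' => -[/= el _].
  case: p lp ep el {wp wp' up up' pA pA'} => [|[e1 x1] p] lp ep el.
    by move: lp lt => /= ->; rewrite ltnn.
  by move: ep; rewrite {1}el /= mem_last.
have := walk_down fh fy wp'; rewrite cons_uniq ep up' => /(_ isT pA').
by move: lp => /= ->; lia.
Qed.

Lemma arborescence_spanning_tree r f : arborescence r f -> spanning_tree (arcs f).
Proof.
move=> Rf; split; first exact: arborescence_connected Rf.
by case: Rf => _ _ [h /descends_acyclic].
Qed.

(** Suppose that [f] and [g] use the same edges and differ at [x], which [g]
    leaves along [e] to [y]. The only other way for [f] to use [e] is to leave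
    [y] along it, towards [x]; by induction on the height for [g], so does [g],
    which would then go back and forth between [x] and [y]. *)
Lemma arborescence_inj r f g :
  arborescence r f -> arborescence r g -> arcs f = arcs g -> f = g.
Proof.
move=> [fr fN [h fh]] [gr gN [h' gh]] fg; apply/ffunP=> x.
have [n] := ubnP (h' x); elim: n x => // n IH x hx.
case: (eqVneq x r) => [->|xr]; first by rewrite fr gr.
case gx: (g x) (gN _ xr) => [[e y]|] // _.
have [exy lt] := gh _ _ _ gx.
have eA : e \in arcs f by rewrite fg; apply/arcsP; exists x, y.
have [[//]|[fy _]] := arc_up_or_down fh exy eA.
have gy : g y = Some (e, x) by rewrite -IH // (leq_trans lt) // -ltnS.
by have [_ lt'] := gh _ _ _ gy; move: (ltn_trans lt lt'); rewrite ltnn.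
Qed.

Lemma walk_of_path A x (p : seq V) : path (adjacent A) x p ->
  exists q, [/\ walk x q, unzip2 q = p & all [in A] (unzip1 q)].
Proof.
elim: p x => [|y p IH] x /=; first by exists [::].
case/andP=> /existsP[e /andP[eA exy]] /IH[q [wq <- qA]].
by exists ((e, y) :: q); rewrite /= exy eA.
Qed.

Lemma walk_edge x p e : walk x p -> e \in unzip1 p ->
  exists u v, [/\ u \in x :: unzip2 p, v \in unzip2 p & joins e u v].
Proof.
elim: p x => [|[e' y] p IH] x //= /andP[exy wp]; rewrite inE.
case/predU1P=> [->|/(IH _ wp)[u [v [up vp euv]]]].
  by exists x, y; rewrite !inE !eqxx.
by exists u, v; split=> //; rewrite inE ?up ?vp orbT.
Qed.

Lemma walk_uniq x p : walk x p -> uniq (x :: unzip2 p) -> uniq (unzip1 p).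
Proof.
elim: p x => [|[e y] p IH] x //= /andP[exy wp] /andP[xp up].
rewrite (IH y) // andbT; apply/negP=> /(walk_edge wp)[u [v [upp vp euv]]].
have [xu|xv] := joins_ends exy euv; first by rewrite xu upp in xp.
by rewrite xv inE vp orbT in xp.
Qed.

(** An edge of [A] outside [B] would close a cycle with a simple path of [B]
    between its ends. *)
Lemma acyclic_sub_connected A (B : {set E}) :
  acyclic A -> B \subset A -> connected_by B -> B = A.
Proof.
move=> Aac BA Bc; apply/eqP; rewrite eqEsubset BA; apply/subsetP=> e eA.
apply/idPn=> eB.
case ee: (ends e) => [x y]; have exy : joins e x y by rewrite /joins ee eqxx.
have /connectP[p0 /shortenP[p pB up _] lp] := Bc y x.
have [q [wq qp qB]] := walk_of_path pB.
have := Aac x ((e, y) :: q); rewrite /is_cycle /= exy wq qp -lp eqxx eA /=.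
rewrite (walk_uniq wq) ?qp //; move: (up) => /= -> /=; rewrite andbT.
move=> /negP; apply; apply/andP; split.
  by apply/negP => /(allP qB); exact/negP.
by apply/allP=> e' /(allP qB) /= /(subsetP BA).
Qed.

(** Every vertex other than [r] leaves along an edge that brings it closer to
    [r], for the distance within [A]. *)
Lemma connected_arborescence A r : connected_by A ->
  exists f, arborescence r f /\ arcs f \subset A.
Proof.
move=> Ac.
have ex_dist x : exists n, [exists p : n.-tuple V,
    path (adjacent A) x p && (last x p == r)].
  have /connectP[p pp lp] := Ac x r; exists (size p).
  by apply/existsP; exists (in_tuple p); rewrite pp lp eqxx.
pose d x := ex_minn (ex_dist x).
pose step x (ey : E * V) := [&& ey.1 \in A, joins ey.1 x ey.2 & d ey.2 < d x].
have ex_step x : x != r -> exists ey, step x ey.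
  move=> xr; rewrite /step {2}/d.
  case: ex_minnP => n /existsP[[p /= /eqP <-] /andP[pp lp]] _.
  case: p pp lp => [|y p] /=; first by move=> _ /eqP xr'; rewrite xr' eqxx in xr.
  case/andP=> /existsP[e /andP[eA exy]] pp lp; exists (e, y) => /=.
  rewrite eA exy /d ltnS; case: ex_minnP => m _; apply.
  by apply/existsP; exists (in_tuple p); rewrite pp lp.
pose f := [ffun x => if x == r then None else [pick ey | step x ey]].
have fP x ey : f x = Some ey -> step x ey.
  by rewrite ffunE; case: ifP => // _; case: pickP => // ? ? [<-].
exists f; split; first split.
- by rewrite ffunE eqxx.
- move=> x xr; rewrite ffunE (negPf xr); case: pickP => // no.
  by have [ey] := ex_step x xr; rewrite no.
- by exists d => x e y /fP /and3P[].
by apply/subsetP => e /arcsP[x [y /fP /and3P[]]].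
Qed.

Lemma spanning_tree_arborescence A r :
  spanning_tree A -> exists2 f, arborescence r f & arcs f = A.
Proof.
case=> Ac Aac; have [f [Rf fA]] := connected_arborescence r Ac.
exists f => //; apply: acyclic_sub_connected => //.
exact: arborescence_connected Rf.
Qed.

(** A spanning tree has exactly one orientation towards a given root. *)
Lemma card_arborescences r :
  #|[set f | `[< arborescence r f >]]| = num_spanning_trees G.
Proof.
rewrite /num_spanning_trees -(@card_in_imset _ _ arcs); last first.
  move=> f g; rewrite !inE => /asboolP Rf /asboolP Rg.
  exact: arborescence_inj Rf Rg.
apply: eq_card => A; rewrite inE; apply/imsetP/asboolP => [[f]|].
  by rewrite inE => /asboolP /arborescence_spanning_tree Rf ->.
move/(spanning_tree_arborescence r) => [f Rf <-]; exists f => //.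
by rewrite inE; apply/asboolP.
Qed.

End Arborescences.

(** * The matrix-tree theorem *)

Local Open Scope ring_scope.

Lemma det_sum_rows (R : comNzRingType) (n : nat) (J : finType)
    (B : J -> 'I_n -> 'I_n -> R) :
  \det (\matrix_(i, j) \sum_o B o i j) =
  \sum_(f : {ffun 'I_n -> J}) \det (\matrix_(i, j) B (f i) i j).
Proof.
rewrite exchange_big /=; apply: eq_bigr => s _; rewrite -big_distrr /=.
congr (_ * _); under eq_bigr do rewrite mxE.
rewrite (bigA_distr_bigA (fun i o => B o i (s i))) /=.
by apply: eq_bigr => f _; apply: eq_bigr => i _; rewrite mxE.
Qed.

Lemma det_eq0_kernel (R : comNzRingType) (n : nat) (A : 'M[R]_n) (v : 'cV[R]_n) i :
  A *m v = 0 -> v i 0 = 1 -> \det A = 0.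
Proof.
move=> Av vi; have := congr1 (fun B => (\adj A *m B) i 0) Av.
by rewrite mulmxA mul_adj_mx mulmx0 mul_scalar_mx !mxE vi mulr1.
Qed.

Section MatrixTree.
Variables (R : comNzRingType) (N : nat) (E : finType) (ends : E -> 'I_N * 'I_N).
Notation G := (@Multigraph 'I_N E ends).
Implicit Type f : {ffun 'I_N -> option (E * 'I_N)}.

Definition multiplicity (x y : 'I_N) : nat := #|[set e : edge G | joins e x y]|.

Definition laplacian : 'M[R]_N := \matrix_(x, y)
  ((x == y)%:R * (\sum_z multiplicity x z)%:R - (multiplicity x y)%:R).

(** The row contributed by the choice [o] of the vertex [x]. It vanishes when
    [o] is not an edge at [x], so that the choices can range over a type that
    does not depend on [x]. *)
Definition choice_row (o : option (E * 'I_N)) (x y : 'I_N) : {poly R} :=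
  if o is Some (e, z) then ((x == y)%:R - (z == y)%:R) *+ @joins G e x z
  else 'X *+ (x == y).

Definition choice_mx f := \matrix_(x, y) choice_row (f x) x y.

Lemma laplacian_choices :
  'X%:M + map_mx polyC laplacian = \matrix_(x, y) \sum_o choice_row o x y.
Proof.
apply/matrixP => x y; rewrite !mxE (bigD1 None) //=; congr (_ + _).
rewrite (reindex_omap Some id) /=; last by case.
pose F e z : {poly R} := ((x == y)%:R - (z == y)%:R) *+ @joins G e x z.
transitivity (\sum_(p : E * 'I_N) F p.1 p.2); last first.
  by apply: eq_big => -[e z]; rewrite /= ?eqxx.
rewrite -pair_bigA exchange_big /=.
have FE z : \sum_e F e z = ((x == y)%:R - (z == y)%:R) * (multiplicity x z)%:R :> {poly R}.
  rewrite /multiplicity cardsE -sum1_card natr_sum mulr_sumr [RHS]big_mkcond /=.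
  apply: eq_bigr => e _; rewrite -topredE /= /F.
  by rewrite mulr1; case: ifP => [|/negbT/negPf] /= H; rewrite [joins _ _ _]H.
rewrite (eq_bigr _ (fun z _ => FE z)) rmorphB rmorphM !rmorph_nat.
under [RHS]eq_bigr do rewrite mulrBl.
rewrite sumrB -mulr_sumr -natr_sum; congr (_ - _).
rewrite (bigD1 y) //= eqxx mul1r big1 ?addr0 // => z /negPf->.
by rewrite mul0r.
Qed.

(** Only the identity contributes to the Leibniz formula. If [s] moves some
    vertex, let [x] be the lowest such vertex. A nonzero factor at [x] forces
    [s x] to be the vertex where [f] leads from [x]; it is lower than [x] and is
    also moved by [s]. *)
Lemma det_choice_forest f h : @descends G f h ->
  \det (choice_mx f) = 'X^#|[set x | f x == None]|.
Proof.
move=> fh; rewrite /determinant (bigD1 (1%g : {perm _})) //= odd_perm1 expr0 mul1r.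
rewrite [X in _ + X]big1 ?addr0 => [|s s1].
  rewrite cardsE -sum1_card expr_sum [RHS]big_mkcond /=; apply: eq_bigr => x _.
  rewrite perm1 mxE unfold_in /choice_row; case fx: (f x) => [[e z]|] /=; last first.
    by rewrite eqxx.
  have [-> lt] := fh _ _ _ fx; rewrite eqxx; case: eqP lt => [->|]; first by rewrite ltnn.
  by rewrite subr0.
have [x0 sx0] : exists x, s x != x.
  apply/existsP; rewrite -negb_forall; apply: contraNN s1 => /forallP s1.
  by apply/eqP/permP => x; rewrite perm1; apply/eqP.
pose x := [arg min_(x < x0 | s x != x) h x].
have [sx hx] : s x != x /\ forall y, s y != y -> (h x <= h y)%N.
  by rewrite /x; case: arg_minnP.
suff -> : \prod_i choice_mx f i (s i) = 0 by rewrite mulr0.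
apply/eqP; rewrite (bigD1 x) //= mxE /choice_row.
case fx: (f x) => [[e z]|]; rewrite (eq_sym x) (negPf sx) ?mulr0n ?mul0r //.
have [exz lt] := fh _ _ _ fx; case: (eqVneq z (s x)) => [zs|_]; last first.
  by rewrite subr0 mul0rn mul0r.
have : s z != z by rewrite zs (inj_eq perm_inj).
by move/hx; rewrite leqNgt lt.
Qed.

(** If [f] leaves some vertex along an edge that is not incident to it, the
    row of that vertex is 0. Otherwise, for want of a height, some vertices never
    reach a stop. A vertex is among these exactly when its successor is, so their indicator vector lies in
    the kernel. *)
Lemma det_choice_cycle f : ~ (exists h, @descends G f h) -> \det (choice_mx f) = 0.
Proof.
move=> nh.
have [valid|] := boolP [forall x, if f x is Some (e, z) then @joins G e x z else true]; last first.
  rewrite negb_forall => /existsP[x]; case fx: (f x) => [[e z]|] // nexz.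
  rewrite (expand_det_row _ x) big1 // => y _.
  by rewrite mxE /choice_row fx (negPf nexz) mulr0n mul0r.
pose next x := if f x is Some (e, z) then z else x.
pose lost x := `[< forall n, f (iter n next x) != None >].
have lost_next x : f x != None -> lost (next x) = lost x.
  move=> fx; apply/asboolP/asboolP => l n; last by rewrite -iterSr.
  by case: n => [//|n]; rewrite iterSr.
have [i li|nolost] := pickP lost.
  apply: (@det_eq0_kernel _ _ _ (\col_x (lost x)%:R) i); last by rewrite mxE li.
  apply/matrixP => x j; rewrite !mxE; under eq_bigr do rewrite !mxE.
  have := forallP valid x; have := lost_next x; rewrite /next /choice_row.
  case fx: (f x) => [[e z]|]; last first.
    move=> _ _; rewrite (bigD1 x) //= eqxx big1 ?addr0.
      suff -> : lost x = false by rewrite mulr0.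
      by apply/asboolP => /(_ 0%N); rewrite /= fx.
    by move=> y /negPf xy; rewrite eq_sym xy mulr0n mul0r.
  move=> /(_ isT) lz exz; rewrite exz.
  under eq_bigr do rewrite mulr1n mulrBl.
  have pick u : \sum_y (u == y)%:R * (lost y)%:R = (lost u)%:R :> {poly R}.
    rewrite (bigD1 u) //= eqxx mul1r big1 ?addr0 // => y /negPf yu.
    by rewrite eq_sym yu mul0r.
  by rewrite sumrB !pick lz subrr.
have exn x : exists n, f (iter n next x) == None.
  apply/not_existsP => l; have : lost x by apply/asboolP => n; apply/negP; exact: l.
  by rewrite nolost.
(* Every vertex stops, and the number of steps before that is a height. *)
exfalso; apply: nh; exists (fun x => ex_minn (exn x)) => x e z fx.
split; first by have := forallP valid x; rewrite fx.
case: (ex_minnP (exn x)) => -[|n] fn _; first by move: fn; rewrite /= fx.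
case: ex_minnP => m _; rewrite ltnS; apply.
by move: fn; rewrite iterSr /next fx.
Qed.

(** A form of the matrix-tree theorem that involves no minor: the coefficient
    of [X] counts the choices that have a single stop and no cycle, that is, the
    pairs of a root and a spanning tree. *)
Theorem matrix_tree :
  (\det ('X%:M + map_mx polyC laplacian))`_1 = (N * num_spanning_trees G)%:R.
Proof.
rewrite laplacian_choices det_sum_rows coef_sum.
have coef1 f : (\det (choice_mx f))`_1 =
    (\sum_(r : 'I_N) `[< @arborescence G r f >])%:R.
  have [[h fh]|nh] := pselect (exists h, @descends G f h); last first.
    rewrite det_choice_cycle // coef0 big1 // => r _.
    by case: asboolP => // -[_ _ /nh].
  rewrite (det_choice_forest fh) coefXn eq_sym; congr (_%:R).
  have arbE r : `[< @arborescence G r f >] = ([set x | f x == None] == [set r]).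
    apply/asboolP/eqP => [[fr fN _]|fr].
      apply/setP => x; rewrite !inE; case: (eqVneq x r) => [->|/fN/negPf //].
      by rewrite fr.
    split; last by exists h.
      by have := set11 r; rewrite -fr inE => /eqP.
    by move=> x; rewrite -in_set1 -fr inE.
  under eq_bigr do rewrite arbE.
  case: (boolP (_ == 1%N)) => [/cards1P[r0 ->]|n1].
    rewrite (bigD1 r0) //= eqxx big1 // => r /negPf nr.
    by rewrite (inj_eq set1_inj) eq_sym nr.
  rewrite big1 // => r _; case: eqP => // Z; by rewrite Z cards1 in n1.
rewrite (eq_bigr _ (fun f _ => coef1 f)) -natr_sum exchange_big /=.
transitivity ((\sum_(r : 'I_N) num_spanning_trees G)%N%:R : R); last first.
  by rewrite sum_nat_const card_ord.
congr (_%:R); apply: eq_bigr => r _.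
rewrite -(@card_arborescences G r) cardsE -sum1_card [RHS]big_mkcond /=.
by apply: eq_bigr => f _; rewrite unfold_in; case: asboolP.
Qed.

End MatrixTree.

(** * Spectrum of circulant graphs *)

Section CirculantSpectrum.
Variables (F : fieldType) (N : nat) (c : seq nat) (z : F).
Hypothesis z_prim : N.-primitive_root z.

Definition circulant_eigenvalue (j : nat) : F :=
  \sum_(a <- c) (2 - (z ^+ (j * a) + z ^- (j * a))).

Notation circulant_ends := (fun e : circulant_edge N c => (val e).1).

Lemma laplacian_mulmx_apply (v : 'cV[F]_N) x :
  (laplacian F circulant_ends *m v) x 0 =
  \sum_y (multiplicity circulant_ends x y)%:R * (v x 0 - v y 0).
Proof.
rewrite mxE; under eq_bigr do rewrite mxE mulrBl.
under [RHS]eq_bigr do rewrite mulrBr.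
rewrite !sumrB -mulr_suml -natr_sum; congr (_ - _).
rewrite (bigD1 x) //= eqxx mul1r [X in _ + X]big1 ?addr0 // => y /negPf yx.
by rewrite eq_sym yx !mul0r.
Qed.

(** The jump [k] permutes the vertices, so that it contributes one neighbour to
    each of them. *)
Lemma jump_target x k : exists y, forall y' : 'I_N, @jump_to N c x y' k = (y' == y).
Proof.
have N_gt0 := prim_order_gt0 z_prim.
have modE (m : nat) (y' : 'I_N) :
    (y' == m %[mod N]) = (y' == Ordinal (ltn_pmod m N_gt0)).
  by rewrite modn_small.
case: k => k [] /=; set a := nth 0%N c k.
  by exists (Ordinal (ltn_pmod (x + a) N_gt0)) => y'; rewrite -modE.
exists (Ordinal (ltn_pmod (x + (N - a %% N)) N_gt0)) => y'.
rewrite -modE /jump_to /= -/a -[in RHS](eqn_modDr a).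
have -> : (x + (N - a %% N) + a = (a %/ N).+1 * N + x)%N.
  by have := ltn_pmod a N_gt0; rewrite {3}(divn_eq a N) mulSn; lia.
by rewrite modnMDl.
Qed.

Lemma jump_to_sum (v : 'cV[F]_N) j x k : v = \col_x z ^+ (j * x) ->
  \sum_y (@jump_to N c x y k)%:R * (v x 0 - v y 0) =
  v x 0 * (1 - (if k.2 then z ^+ (j * nth 0%N c k.1)
                else z ^- (j * nth 0%N c k.1))).
Proof.
move=> ->; have [y0 yP] := jump_target x k.
rewrite (bigD1 y0) //= yP eqxx mul1r big1 ?addr0; last first.
  by move=> y /negPf yy0; rewrite yP yy0 mul0r.
have z0 : z != 0.
  by rewrite (prim_root_eq0 z_prim) -lt0n (prim_order_gt0 z_prim).
rewrite !mxE mulrBr mulr1; congr (_ - _).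
have := yP y0; rewrite eqxx; case: k {yP} => k [] /=; rewrite /jump_to /=;
  rewrite -(eq_prim_root_expr z_prim) => /eqP h.
  by rewrite -exprD -mulnDr ![(j * _)%N]mulnC !exprM h.
apply: (mulIf (x := z ^+ (j * nth 0%N c k))); first by rewrite expf_neq0.
rewrite mulfVK ?expf_neq0 //.
by rewrite -exprD -mulnDr ![(j * _)%N]mulnC !exprM h.
Qed.

(** The edges at [x] are regrouped by jumps; a jump by [a] in either direction
    multiplies the coordinate at [x] by [z ^ (j a)] or by its inverse. *)
Lemma laplacian_eigenvector j (v := \col_x z ^+ (j * x) : 'cV[F]_N) :
  laplacian F circulant_ends *m v = circulant_eigenvalue j *: v.
Proof.
apply/matrixP => x i; rewrite ord1 laplacian_mulmx_apply [RHS]mxE.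
transitivity (\sum_k \sum_y (@jump_to N c x y k)%:R * (v x 0 - v y 0)).
  rewrite exchange_big /=; apply: eq_bigr => y _; rewrite -mulr_suml.
  have [<-|xy] := eqVneq x y; first by rewrite subrr !mulr0.
  rewrite /multiplicity; have := card_joins_circulant c xy.
  rewrite /circulant => ->.
  rewrite -natr_sum cardsE -sum1_card; congr (_%:R * _); rewrite [LHS]big_mkcond /=.
  by apply: eq_bigr => k _; rewrite -topredE /=; case: (jump_to _ _ _).
rewrite (eq_bigr _ (fun k _ => jump_to_sum x k (erefl v))) -mulr_sumr mulrC.
congr (_ * _); rewrite /circulant_eigenvalue (big_nth 0%N) big_mkord.
rewrite -(pair_bigA _ (fun (k : 'I_(size c)) (b : bool) => 1 -
  (if b then z ^+ (j * nth 0%N c k) else z ^- (j * nth 0%N c k)))) /=.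
by apply: eq_bigr => k _; rewrite big_bool /=; ring.
Qed.

(** The eigenvectors are the columns of a Vandermonde matrix of distinct powers
    of [z], which diagonalizes the Laplacian. *)
Lemma det_X_laplacian :
  \det ('X%:M + map_mx polyC (laplacian F circulant_ends)) =
  \prod_(j < N) ('X + (circulant_eigenvalue j)%:P).
Proof.
pose V : 'M[F]_N := Vandermonde N (\row_j z ^+ j).
pose d := \row_(j < N) ('X + (circulant_eigenvalue j)%:P).
have detV : \det (map_mx polyC V) != 0.
  rewrite det_map_mx polyC_eq0 det_Vandermonde.
  apply/prodf_neq0 => i _; apply/prodf_neq0 => j ij.
  rewrite !mxE subr_eq0 (eq_prim_root_expr z_prim) !modn_small //.
  by rewrite gtn_eqF.
apply: (mulIf detV); rewrite -det_mulmx.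
transitivity (\det (map_mx polyC V *m diag_mx d)); last first.
  rewrite det_mulmx det_diag mulrC; congr (_ * _).
  by apply: eq_bigr => j _; rewrite mxE.
congr (\det _); apply/matrixP => x j.
rewrite mulmxDl mul_scalar_mx -map_mxM /= mul_mx_diag !mxE mulrDr [_ * 'X]mulrC.
congr (_ + _); rewrite -polyCM; congr (_%:P).
have /matrixP/(_ x 0) := laplacian_eigenvector j; rewrite !mxE.
rewrite mulrC exprM => <-; apply: eq_bigr => y _.
by rewrite !mxE exprM.
Qed.

(** The factor of [j = 0] in [det_X_laplacian] is [X] itself. *)
Theorem num_spanning_trees_circulant :
  (N * num_spanning_trees (circulant N c))%:R =
  \prod_(1 <= j < N) circulant_eigenvalue j.
Proof.
rewrite -(@matrix_tree _ _ _ circulant_ends) det_X_laplacian.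
rewrite -(big_mkord xpredT (fun j => 'X + (circulant_eigenvalue j)%:P)).
rewrite big_ltn ?(prim_order_gt0 z_prim) //.
have -> : circulant_eigenvalue 0 = 0.
  by rewrite /circulant_eigenvalue big1 // => a _; rewrite mul0n invr1; ring.
rewrite addr0 coefXM /= -horner_coef0 horner_prod; apply: eq_bigr => j _.
by rewrite !hornerE.
Qed.

End CirculantSpectrum.

(** * Sums of Chebyshev polynomials *)

Lemma two_step_ind (Q : nat -> Prop) :
  Q 0%N -> Q 1%N -> (forall m, Q m -> Q m.+1 -> Q m.+2) -> forall m, Q m.
Proof.
move=> Q0 Q1 QS m; suff [] : Q m /\ Q m.+1 by [].
by elim: m => [|m [IH0 IH1]]; split=> //; apply: QS.
Qed.

Lemma cheb_joukowski (F : fieldType) (x z : F) m :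
  z != 0 -> 2 * x = z + z^-1 -> 2 * (cheb F m).[x] = z ^+ m + z ^- m.
Proof.
move=> z0 xz; elim/two_step_ind: m => [||m IH0 IH1]; rewrite ?cheb0 ?cheb1 ?chebSS.
- by rewrite hornerE expr0 invr1 mulr1.
- by rewrite hornerE expr1.
rewrite hornerD hornerN hornerZ hornerM hornerX mulrBr IH0.
rewrite [2 * (x * _)]mulrA mulrCA xz IH1 !exprS.
by field; rewrite expf_neq0 ?z0.
Qed.

Lemma cheb_horner1 (R : comNzRingType) m : (cheb R m).[1] = 1.
Proof.
elim/two_step_ind: m => [||m IH0 IH1]; rewrite ?cheb0 ?cheb1 ?chebSS.
- by rewrite hornerE.
- by rewrite hornerE.
by rewrite hornerD hornerN hornerZ hornerM hornerX IH0 IH1; ring.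
Qed.

Lemma cheb_deriv1 (R : comNzRingType) m : (cheb R m)^`().[1] = (m ^ 2)%:R.
Proof.
elim/two_step_ind: m => [||m IH0 IH1]; rewrite ?cheb0 ?cheb1 ?chebSS.
- by rewrite derivC hornerE.
- by rewrite derivX hornerE.
rewrite derivB derivZ derivM derivX mul1r hornerD hornerN hornerZ hornerD.
rewrite hornerM hornerX cheb_horner1 IH0 IH1.
by rewrite !natrX -!natr1; ring.
Qed.

Lemma size_cheb (R : comNzRingType) m : (size (cheb R m) <= m.+1)%N.
Proof.
elim/two_step_ind: m => [||m IH0 IH1]; rewrite ?cheb0 ?cheb1 ?chebSS.
- by rewrite size_poly1.
- by rewrite size_polyX.
apply: leq_trans (size_polyD _ _) _; rewrite geq_max size_polyN.
rewrite (leq_trans IH0) ?andbT //; last by lia.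
apply: leq_trans (size_scale_leq _ _) _.
by apply: leq_trans (size_polyMleq _ _) _; rewrite size_polyX.
Qed.

Lemma coef_cheb (R : comNzRingType) m : (cheb R m.+1)`_m.+1 = 2 ^+ m.
Proof.
elim: m => [|m IH]; first by rewrite cheb1 coefX.
rewrite chebSS coefB coefZ coefXM IH [(cheb R m)`__]nth_default ?subr0 ?exprS //.
by apply: leq_trans (size_cheb _ _) _; lia.
Qed.

Lemma lists_roots_factor (F : closedFieldType) (P : {poly F}) d (w : 'I_d -> F) :
  P != 0 -> lists_roots P w -> P = lead_coef P *: \prod_j ('X - (w j)%:P).
Proof.
move=> P0 wP; have [r Pr] := closed_field_poly_normal P.
rewrite {1}Pr; congr (_ *: _).
rewrite -(big_map w xpredT (fun z => 'X - z%:P)); apply: perm_big.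
apply/allP => z _ /=; rewrite -[X in X == _]mu_prod_XsubC.
have -> : mup z (\prod_(y <- r) ('X - y%:P)) = mup z P.
  rewrite [in RHS]Pr -mul_polyC mupMr // rootC lead_coef_eq0 //.
by rewrite -wP cardsE cardE size_filter count_map.
Qed.

(** Only the largest index reaches the top degree. Doubling makes the leading
    coefficient a power of two with exponent the degree, hence the form of
    [cheb_sum_factor]. *)
Lemma cheb_sum_lead (C : numClosedFieldType) (s : seq nat) (c : C)
    (P := \sum_(a <- s) cheb C a - c%:P) :
  s != [::] -> sorted ltn s -> (forall a, a \in s -> 0 < a)%N ->
  size P = (last 0%N s).+1 /\ 2 * lead_coef P = 2 ^+ (last 0%N s).
Proof.
move=> sN ss s_gt0.
suff [sizeP coefP] : (size P <= (last 0%N s).+1)%N /\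
    2 * P`_(last 0%N s) = 2 ^+ (last 0%N s).
  have sizePE : size P = (last 0%N s).+1.
    apply/eqP; rewrite eqn_leq sizeP ltnNge; apply/negP => /(nth_default 0) P0.
    by move/eqP: coefP; rewrite P0 mulr0 eq_sym expf_eq0 pnatr_eq0 andbF.
  by rewrite /lead_coef sizePE.
rewrite {}/P; case: (lastP s) sN ss s_gt0 => [//|s' m] _ ss s_gt0.
move: ss; rewrite (sorted_pairwise ltn_trans) pairwise_rcons => /andP[/allP s'm _].
rewrite last_rcons -cats1 big_cat big_seq1 /=.
have: (0 < m)%N by rewrite s_gt0 // mem_rcons inE eqxx.
case: m s'm {s_gt0} => // m s'm _; set Q := \sum_(_ <- _) _.
have sizeQ : (size Q <= m.+1)%N.
  apply: leq_trans (size_sum _ _ _) _; rewrite big_seq; elim/big_ind: _ => //.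
    by move=> x y; rewrite geq_max => -> ->.
  by move=> a /s'm am; apply: leq_trans (size_cheb _ _) _.
have sizec : (size c%:P <= m.+1)%N by rewrite (leq_trans (size_polyC_leq1 _)).
split.
  rewrite (leq_trans (size_polyD _ _)) // geq_max size_polyN.
  rewrite (leq_trans (size_polyD _ _)) ?geq_max ?size_cheb; last by rewrite ltnW.
  by rewrite ltnW // leqW.
rewrite coefB coefD coef_cheb [Q`_ _]nth_default // [(c%:P)`_ _]nth_default //.
by rewrite add0r subr0 exprS.
Qed.

Lemma cheb_sum_factor (C : numClosedFieldType) (s : seq nat) (c : C)
    (w : 'I_(last 0%N s) -> C) (P := \sum_(a <- s) cheb C a - c%:P) :
  s != [::] -> sorted ltn s -> (forall a, a \in s -> 0 < a)%N ->
  lists_roots P w -> 2 *: P = \prod_j (2 *: 'X - (2 * w j)%:P).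
Proof.
move=> sN ss s_gt0 wP.
have [sizeP leadP] := cheb_sum_lead c sN ss s_gt0.
have P0 : P != 0 by rewrite -size_poly_eq0 sizeP.
rewrite [in LHS](lists_roots_factor P0 wP) scalerA leadP -[X in _ ^+ X]card_ord.
rewrite -prodr_const -scaler_prod.
by apply: eq_bigr => j _; rewrite scalerBr -!mul_polyC -polyCM.
Qed.

(** * Products over roots of unity *)

Section ProductOverRootsOfUnity.
Variables (C : numClosedFieldType) (n : nat) (z : C).
Hypothesis z_prim : n.-primitive_root z.

Lemma prod_sub_unity_roots (x a : C) :
  \prod_(0 <= t < n) (x - a * z ^+ t) = x ^+ n - a ^+ n.
Proof.
have [->|a0] := eqVneq a 0.
  under eq_bigr do rewrite mul0r subr0.
  by rewrite prodr_const_nat subn0 expr0n gtn_eqF ?(prim_order_gt0 z_prim) ?subr0.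
have := congr1 (fun p => a ^+ n * p.[x / a]) (factor_Xn_sub_1 z_prim).
rewrite horner_prod hornerD hornerN hornerXn hornerC mulrBr mulr1 -exprMn mulrCA.
rewrite divff // mulr1 => <-.
rewrite -[X in a ^+ X](subn0 n) -prodr_const_nat -big_split /=.
by apply: eq_bigr => t _; rewrite hornerXsubC mulrBr mulrCA divff // mulr1.
Qed.

(** The two solutions [v] are [w + sqrt (w ^ 2 - 1)] and [w - sqrt (w ^ 2 - 1)]. *)
Lemma joukowski_surj (w : C) : exists2 v, v != 0 & 2 * w = v + v^-1.
Proof.
pose r := sqrtC (w ^+ 2 - 1).
have e : (w + r) * (w - r) = 1 by rewrite mulrC -subr_sqr sqrtCK; ring.
have v0 : w + r != 0.
  by apply/negP => /eqP v0; move: e; rewrite v0 mul0r => /esym/eqP; rewrite oner_eq0.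
exists (w + r) => //; have -> : (w + r)^-1 = w - r by apply: (mulfI v0); rewrite e divff.
by ring.
Qed.

(** With [2 w = v + v ^ -1], the factor at [b = a z ^ t] is
    [(v - b) (v ^ -1 - b) / (- b)], and the product of each of the three parts
    over [t] is given by [prod_sub_unity_roots]. *)
Lemma prod_joukowski (w a : C) : a != 0 ->
  \prod_(0 <= t < n) (2 * w - (a * z ^+ t + (a * z ^+ t)^-1)) =
  2 * (cheb C n).[w] - (a ^+ n + a ^- n).
Proof.
move=> a0; have [v v0 wv] := joukowski_surj w.
have z0 : z != 0.
  by rewrite (prim_root_eq0 z_prim) -lt0n (prim_order_gt0 z_prim).
rewrite (cheb_joukowski n v0 wv) wv.
have E t : true -> v + v^-1 - (a * z ^+ t + (a * z ^+ t)^-1) =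
    (v - a * z ^+ t) * (v^-1 - a * z ^+ t) / (0 - a * z ^+ t).
  by move=> _; field; rewrite v0 a0 expf_neq0.
rewrite (eq_bigr _ (fun t => E t)) big_split prodfV big_split /=.
rewrite !prod_sub_unity_roots expr0n gtn_eqF ?(prim_order_gt0 z_prim) //=.
by rewrite exprVn; field; rewrite !expf_neq0.
Qed.

Lemma prod_sub_nontrivial_roots (x : C) :
  \prod_(1 <= t < n) (x - z ^+ t) = \sum_(i < n) x ^+ i.
Proof.
have poly_eq : \prod_(1 <= t < n) ('X - (z ^+ t)%:P) = \sum_(i < n) 'X^i.
  apply: (mulfI (negbT (polyXsubC_eq0 1))).
  rewrite polyC1 -subrX1 -(factor_Xn_sub_1 z_prim).
  by rewrite [RHS]big_ltn ?(prim_order_gt0 z_prim).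
have := congr1 (horner_eval x) poly_eq; rewrite /horner_eval horner_prod horner_sum.
under eq_bigr do rewrite hornerXsubC.
by under [in RHS]eq_bigr do rewrite hornerXn.
Qed.

Lemma prod_joukowski_nontrivial (w : C) : w != 1 ->
  \prod_(1 <= t < n) (2 * w - (z ^+ t + z ^- t)) =
  (2 * (cheb C n).[w] - 2) / (2 * w - 2).
Proof.
move=> w1; have w2 : 2 * w - 2 != 0.
  by rewrite -[X in _ - X]mulr1 -mulrBr mulf_neq0 ?pnatr_eq0 ?subr_eq0.
apply: (mulIf w2); rewrite mulfVK //.
have := prod_joukowski w (oner_neq0 C); rewrite expr1n invr1 -[1 + 1]/2 => <-.
rewrite [RHS]big_ltn ?(prim_order_gt0 z_prim) // expr0 mulr1 invr1 mulrC.
by congr (_ * _); apply: eq_bigr => t _; rewrite mul1r.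
Qed.

(** The factor at [b = z ^ t] is [(1 - b) ^ 2 / (- b)]. By
    [prod_sub_nontrivial_roots] the factors [1 - b] multiply to [n], and the
    factors [0 - b] to 1. *)
Lemma prod_joukowski_at1 :
  \prod_(1 <= t < n) (2 - (z ^+ t + z ^- t)) = n%:R ^+ 2.
Proof.
have z0 : z != 0.
  by rewrite (prim_root_eq0 z_prim) -lt0n (prim_order_gt0 z_prim).
have E t : true -> 2 - (z ^+ t + z ^- t) =
    (1 - z ^+ t) * (1 - z ^+ t) / (0 - z ^+ t).
  by move=> _; field; rewrite expf_neq0.
rewrite (eq_bigr _ (fun t => E t)) big_split prodfV big_split /=.
rewrite !prod_sub_nontrivial_roots.
under eq_bigr do rewrite expr1n.
rewrite sumr_const card_ord.
case: (n) (prim_order_gt0 z_prim) => // n' _.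
rewrite big_ord_recl big1 ?addr0 ?invr1 ?mulr1 // => i _.
by rewrite expr0n.
Qed.

End ProductOverRootsOfUnity.

(** * The formula for a primitive root of unity *)

(** The index 0 belongs to the class [u = 0] only, and is missing there. *)
Lemma prod_residue_classes (R : comNzRingType) (g : nat -> R) (b n : nat) :
  (0 < b)%N -> (0 < n)%N ->
  \prod_(1 <= i < b * n) g i =
  \prod_(1 <= t < n) g (b * t)%N *
  \prod_(1 <= u < b) \prod_(0 <= t < n) g (u + b * t)%N.
Proof.
(* Setting the value at 0 to 1 turns both sides into full products. *)
move=> b0 n0; pose g' i := if i == 0%N then 1 else g i.
transitivity (\prod_(0 <= i < b * n) g' i).
  rewrite [RHS]big_ltn ?muln_gt0 ?b0 // mul1r.
  by apply: eq_big_nat => -[|i].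
transitivity (\prod_(0 <= u < b) \prod_(0 <= t < n) g' (u + b * t)%N).
  rewrite mulnC big_nat_mul exchange_big_nat /=; apply: eq_bigr => t _.
  rewrite -{1}[(t * b)%N]add0n big_addn mulSn addnK.
  by apply: eq_bigr => u _; rewrite mulnC.
rewrite big_ltn // big_ltn // muln0 mul1r; congr (_ * _).
  by apply: eq_big_nat => t /andP[t0 _]; rewrite /g' add0n muln_eq0 !gtn_eqF.
by apply: eq_big_nat => u /andP[u0 _]; apply: eq_bigr => t _;
  rewrite /g' addn_eq0 gtn_eqF.
Qed.

Section RootOfUnityForm.
Variables (C : numClosedFieldType) (b n : nat) (s alpha : seq nat) (z : C).
Variable w : nat -> 'I_(last 0%N s) -> C.
Hypothesis z_prim : (b * n).-primitive_root z.
Hypotheses (sN : s != [::]) (ss : sorted ltn s)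
  (s_gt0 : forall a, a \in s -> (0 < a)%N).

(** The polynomials whose roots are the [w u], with
    [2 sin (pi u a / b) ^ 2 = 1 - cos (2 pi u a / b)] written by means of
    powers of [z]. *)
Definition cheb_equation u : {poly C} := \sum_(a <- s) cheb C a
  - ((size s)%:R + \sum_(a <- alpha)
       (1 - (z ^+ (u * (a * n)) + z ^- (u * (a * n))) / 2))%:P.

Hypothesis w_roots : forall u, (u < b)%N -> lists_roots (cheb_equation u) (w u).

Let jumps := s ++ [seq (a * n)%N | a <- alpha].

Let z0 : z != 0.
Proof. by rewrite (prim_root_eq0 z_prim) -lt0n (prim_order_gt0 z_prim). Qed.

Let bn_gt0 : (0 < b)%N /\ (0 < n)%N.
Proof. by apply/andP; rewrite -muln_gt0 (prim_order_gt0 z_prim). Qed.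

Let zb_prim : n.-primitive_root (z ^+ b).
Proof.
have := dvdn_prim_root z_prim (dvdn_mull b (dvdnn n)).
by rewrite mulnK ?bn_gt0.2 //; case: bn_gt0.
Qed.

Let q_neq0 : (\sum_(a <- s) a ^ 2)%:R != 0 :> C.
Proof.
rewrite pnatr_eq0; case: s sN s_gt0 => // a r _ r_gt0.
by rewrite big_cons addn_eq0 expn_eq0 gtn_eqF // r_gt0 ?mem_head.
Qed.

Lemma cheb_equation_factor u : (u < b)%N ->
  2 *: cheb_equation u = \prod_j (2 *: 'X - (2 * w u j)%:P).
Proof. by move=> ub; apply: cheb_sum_factor => //; exact: w_roots. Qed.

(** The jumps [a * n] see [i] only modulo [b], because [z] has order [b * n]. *)
Lemma eigenvalue_cheb_equation u t (i := (u + b * t)%N) :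
  circulant_eigenvalue jumps z i =
  - (2 *: cheb_equation u).[(z ^+ i + z ^- i) / 2].
Proof.
set x := _ / 2; have zi0 : z ^+ i != 0 by rewrite expf_neq0.
have two0 : 2 != 0 :> C by rewrite pnatr_eq0.
have xE : 2 * x = z ^+ i + (z ^+ i)^-1 by rewrite mulrC divfK.
rewrite /circulant_eigenvalue big_cat big_map hornerZ hornerD hornerN hornerC /=.
rewrite horner_sum mulrBr opprB mulrDr !mulr_sumr addrAC; congr (_ + _).
  rewrite -sum1_size natr_sum mulr_sumr -sumrB; apply: eq_bigr => a _.
  by rewrite mulr1 (cheb_joukowski a zi0 xE) !exprM.
apply: eq_bigr => a _; have -> : z ^+ (i * (a * n)) = z ^+ (u * (a * n)).
  apply/eqP; rewrite (eq_prim_root_expr z_prim) /i mulnDl.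
  by rewrite (mulnC b) mulnACA addnC modnMDl.
by rewrite mulrBr mulr1 mulrCA divff ?mulr1.
Qed.

Lemma norm_eigenvalue u t (i := (u + b * t)%N) : (u < b)%N ->
  `|circulant_eigenvalue jumps z i| =
  \prod_j `|2 * w u j - (z ^+ i + z ^- i)|.
Proof.
move=> ub; rewrite eigenvalue_cheb_equation cheb_equation_factor // normrN.
rewrite horner_prod normr_prod; apply: eq_bigr => j _.
rewrite hornerD hornerN hornerZ hornerX hornerC distrC.
by congr (`|_ - _|); rewrite mulrC divfK // pnatr_eq0.
Qed.

Lemma prod_norm_eigenvalues u : (u < b)%N ->
  \prod_(0 <= t < n) `|circulant_eigenvalue jumps z (u + b * t)| =
  \prod_j `|2 * (cheb C n).[w u j] - (z ^+ (n * u) + z ^- (n * u))|.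
Proof.
move=> ub; rewrite (eq_bigr _ (fun t _ => norm_eigenvalue t ub)) exchange_big /=.
apply: eq_bigr => j _; rewrite -normr_prod mulnC exprM.
rewrite -(prod_joukowski zb_prim (w u j) (expf_neq0 u z0)).
by congr (`|_|); apply: eq_bigr => t _; rewrite exprD exprM.
Qed.

(** At [X = 1] the product of the [2 X - 2 w] vanishes, so that some root is 1.
    Its factor has derivative 2, so that the derivative of the whole product
    at 1 is twice the product of the other factors; it is also [2 q], because
    [T_a' (1) = a ^ 2]. As [q] is not zero, no other root is 1. *)
Lemma cheb_equation0_roots : exists2 j0, w 0%N j0 = 1 &
  (forall j, (w 0%N j != 1) = (j != j0)) /\
  \prod_(j | j != j0) `|2 * w 0%N j - 2| = (\sum_(a <- s) a ^ 2)%:R.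
Proof.
have [b0 _] := bn_gt0; have two0 : 2 != 0 :> C by rewrite pnatr_eq0.
have P0 : cheb_equation 0 = \sum_(a <- s) cheb C a - (size s)%:R%:P.
  rewrite /cheb_equation [X in (_ + X)%:P]big1 ?addr0 // => a _.
  by rewrite mul0n expr0 invr1 divff ?subrr.
have := cheb_equation_factor b0; rewrite P0 => fact.
have := congr1 (horner_eval 1) fact.
rewrite /horner_eval hornerZ hornerD hornerN hornerC horner_sum.
under [in LHS]eq_bigr do rewrite cheb_horner1.
rewrite -[X in _ - X]mulr1 -sum1_size natr_sum mulr1 subrr mulr0 horner_prod.
move=> /esym/eqP/prodf_eq0[j0 _].
rewrite hornerD hornerN hornerZ hornerX hornerC -mulrBr mulf_eq0 (negPf two0).
rewrite subr_eq0 eq_sym => /eqP wj0.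
have dQ : \prod_(j | j != j0) (2 - 2 * w 0%N j) = (\sum_(a <- s) a ^ 2)%:R.
  have := congr1 (fun p => p^`().[1]) fact.
  rewrite derivZ derivB derivC subr0 hornerZ raddf_sum /= horner_sum.
  under [in LHS]eq_bigr do rewrite cheb_deriv1.
  rewrite -natr_sum (bigD1 j0) //= wj0 derivM hornerD !hornerM horner_prod.
  rewrite derivB derivC subr0 derivZ derivX.
  rewrite !(hornerZ, hornerD, hornerN, hornerX, hornerC, mulr1).
  rewrite subrr mul0r addr0 => /(mulfI two0) ->.
  by apply: eq_bigr => j _; rewrite !(hornerZ, hornerD, hornerN, hornerX, hornerC, mulr1).
exists j0 => //; split.
  move=> j; have [->|jj0] := eqVneq j j0; first by rewrite wj0 eqxx.
  apply: contraNneq q_neq0 => wj; rewrite -dQ; apply/prodf_eq0; exists j => //.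
  by rewrite wj mulr1 subrr.
rewrite -[RHS]normr_nat -dQ normr_prod.
by apply: eq_bigr => j _; rewrite distrC.
Qed.

Lemma prod_norm_eigenvalues0 :
  \prod_(1 <= t < n) `|circulant_eigenvalue jumps z (b * t)| =
  n%:R ^+ 2 / (\sum_(a <- s) a ^ 2)%:R *
  \prod_(j | w 0%N j != 1) `|2 * (cheb C n).[w 0%N j] - 2|.
Proof.
have [b0 n0] := bn_gt0.
have [j0 wj0 [wj prodj]] := cheb_equation0_roots.
under eq_bigr do rewrite -[(b * _)%N]add0n (norm_eigenvalue _ b0).
rewrite exchange_big (bigD1 j0) //= wj0 -normr_prod mulr1.
under eq_bigr do rewrite exprM.
rewrite (prod_joukowski_at1 zb_prim) ger0_norm ?exprn_ge0 ?ler0n // -mulrA.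
congr (_ * _); rewrite (eq_bigl _ _ wj).
have -> : (\sum_(a <- s) a ^ 2)%:R^-1 = \prod_(j | j != j0) `|2 * w 0%N j - 2|^-1.
  by rewrite prodfV prodj.
rewrite -big_split; apply: eq_bigr => j jj0; rewrite -normr_prod.
under eq_bigr do rewrite exprM.
by rewrite (prod_joukowski_nontrivial zb_prim) ?wj // normrM normfV mulrC.
Qed.

Lemma num_spanning_trees_root_of_unity :
  (num_spanning_trees (circulant (b * n) jumps))%:R =
  n%:R / (b * \sum_(a <- s) a ^ 2)%N%:R
    * \prod_(j | w 0%N j != 1) `|2 * (cheb C n).[w 0%N j] - 2|
    * \prod_(1 <= u < b) \prod_j
        `|2 * (cheb C n).[w u j] - (z ^+ (n * u) + z ^- (n * u))|.
Proof.
have [b0 n0] := bn_gt0.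
have bC : b%:R != 0 :> C by rewrite pnatr_eq0 -lt0n.
have nC : n%:R != 0 :> C by rewrite pnatr_eq0 -lt0n.
have := congr1 Num.norm (num_spanning_trees_circulant jumps z_prim).
rewrite normr_nat normr_prod prod_residue_classes // prod_norm_eigenvalues0.
under [in RHS]eq_big_nat => u /andP[_ ub] do rewrite prod_norm_eigenvalues //.
rewrite !natrM; move: (\prod_(_ | _) _) (\prod_(_ <= _ < _) _) => A B e.
apply: (mulfI (mulf_neq0 bC nC)); rewrite e; field.
by rewrite bC q_neq0.
Qed.

End RootOfUnityForm.

(** * The formula with trigonometric functions *)

Local Open Scope complex_scope.

Section UnitCircle.
Variables (R : realType) (N : nat).
Hypothesis N_gt0 : (0 < N)%N.

Definition expi (t : R) : R[i] := cos t +i* sin t.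

Lemma expi_exp t m : expi t ^+ m = expi (m%:R * t).
Proof.
elim: m => [|m IH]; first by rewrite expr0 mul0r /expi cos0 sin0.
rewrite exprS IH -natr1 mulrDl mul1r addrC /expi cosD sinD.
by apply/eqP; rewrite eq_complex /=; apply/andP; split; apply/eqP; ring.
Qed.

Lemma expi_addV t m : expi t ^+ m + expi t ^- m = (2 * cos (m%:R * t))%:C.
Proof.
rewrite expi_exp; set u := _ * t.
have -> : (expi u)^-1 = expi (- u).
  have e : expi u * expi (- u) = 1.
    rewrite /expi cosN sinN; apply/eqP; rewrite eq_complex /=.
    by rewrite !mulrN opprK -!expr2 cos2Dsin2 mulrC addNr !eqxx.
  have u0 : expi u != 0.
    by apply/eqP => u0; move/eqP: e; rewrite u0 mul0r eq_sym oner_eq0.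
  by apply: (mulfI u0); rewrite e divff.
rewrite /expi cosN sinN; apply/eqP; rewrite eq_complex /= subrr eqxx andbT.
by apply/eqP; ring.
Qed.

Lemma cos_double (t : R) : cos (2 * t) = 1 - 2 * sin t ^+ 2.
Proof. by rewrite mulr_natl cos_mulr2n cos2sin2; ring. Qed.

(** If the order [m] were less than [N], then [cos (2 pi m / N) = 1] would give
    [sin (pi m / N) = 0], but [pi m / N] lies strictly between 0 and [pi]. *)
Lemma expi_primitive : N.-primitive_root (expi (2 * pi / N%:R)).
Proof.
have N0 : N%:R != 0 :> R by rewrite pnatr_eq0 -lt0n.
have zN : expi (2 * pi / N%:R) ^+ N = 1.
  rewrite expi_exp mulrC divfK // /expi mulr_natl cos2pi sin_mulr2n sinpi.
  by rewrite mulr0 mul0rn.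
have [m m_prim /dvdn_leq mN] := prim_order_exists N_gt0 zN.
have m_gt0 := prim_order_gt0 m_prim.
move: (mN N_gt0); rewrite leq_eqVlt => /predU1P[eq_mN|ltmN].
  by rewrite -{1}eq_mN.
have := prim_expr_order m_prim; rewrite expi_exp => /eqP.
rewrite eq_complex /= => /andP[/eqP c1 _].
have mE : m%:R * (2 * pi / N%:R) = 2 * (pi * (m%:R / N%:R)) :> R by ring.
have : 0 < sin (pi * (m%:R / N%:R)) :> R.
  apply: sin_gt0_pi; rewrite mulr_gt0 ?pi_gt0 ?divr_gt0 ?ltr0n //=.
  by rewrite gtr_pMr ?pi_gt0 // ltr_pdivrMr ?ltr0n // mul1r ltr_nat.
move=> s_gt0; exfalso; move: c1; rewrite mE cos_double; nra.
Qed.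

End UnitCircle.

Unset Implicit Arguments.
Set Strict Implicit.
Set Printing Implicit Defensive.

Theorem theorem1 (R : realType) (k l beta n : nat)
    (s : k.-tuple nat) (alpha : l.-tuple nat)
    (w : nat -> 'I_(last 0%N s) -> R[i]) :
  (1 <= k)%N -> (1 <= beta)%N -> (1 <= n)%N ->
  sorted ltn s -> (forall a, a \in s -> (1 <= a <= (beta * n)./2)%N) ->
  sorted ltn alpha -> (forall a, a \in alpha -> (1 <= a <= beta./2)%N) ->
  (forall u, (u < beta)%N -> lists_roots
     (\sum_(a <- s) cheb R[i] a
      - (k%:R + 2 * \sum_(a <- alpha)
           sin (pi * u%:R * a%:R / beta%:R) ^+ 2)%:C%:P)
     (w u)) ->
  let q := (\sum_(a <- s) a ^ 2)%N in
  let tau := num_spanning_trees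
    (circulant (beta * n) (s ++ [seq (a * n)%N | a <- alpha])) in
  tau%:R = n%:R / (beta * q)%N%:R
    * \prod_(j < last 0%N s | w 0%N j != 1)
        `|2 * (cheb R[i] n).[w 0%N j] - 2|
    * \prod_(1 <= u < beta) \prod_(j < last 0%N s)
        `|2 * (cheb R[i] n).[w u j]
          - (2 * cos (2 * pi * u%:R / beta%:R))%:C|.
Proof.
move=> k_gt0 b_gt0 n_gt0 ss s_bound _ _ w_roots q tau.
have N_gt0 : (0 < beta * n)%N by rewrite muln_gt0 b_gt0.
have z_prim := expi_primitive R N_gt0; set z := expi _ in z_prim.
have sN : tval s != [::] by rewrite -size_eq0 size_tuple -lt0n.
have s_gt0 a : a \in tval s -> (0 < a)%N by case/s_bound/andP.
have bR : beta%:R != 0 :> R by rewrite pnatr_eq0 -lt0n.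
have nR : n%:R != 0 :> R by rewrite pnatr_eq0 -lt0n.
have zE m : z ^+ (n * m) + z ^- (n * m) = (2 * cos (2 * pi * m%:R / beta%:R))%:C.
  rewrite expi_addV; congr (_ * cos _)%:C; rewrite !natrM.
  by field; rewrite bR nR.
have w_roots' u : (u < beta)%N -> lists_roots (cheb_equation n s alpha z u) (w u).
  move=> ub; rewrite /cheb_equation size_tuple.
  suff -> : k%:R + \sum_(a <- alpha) (1 - (z ^+ (u * (a * n)) + z ^- (u * (a * n))) / 2)
      = (k%:R + 2 * \sum_(a <- alpha) sin (pi * u%:R * a%:R / beta%:R) ^+ 2)%:C.
    exact: w_roots.
  rewrite rmorphD rmorph_nat mulr_sumr rmorph_sum; congr (_ + _).
  apply: eq_bigr => a _; rewrite (_ : u * (a * n) = n * (a * u))%N; last by lia.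
  rewrite zE.
  have -> : 2 * pi * (a * u)%:R / beta%:R = 2 * (pi * u%:R * a%:R / beta%:R) :> R.
    by rewrite natrM; ring.
  rewrite cos_double -[1 in LHS](rmorph1 (real_complex R)) rmorphM rmorph_nat.
  by rewrite mulrAC divff ?pnatr_eq0 // mul1r -rmorphB; congr (_%:C); ring.
rewrite /tau (num_spanning_trees_root_of_unity z_prim sN ss s_gt0 w_roots').
by congr (_ * _); under eq_bigr do under eq_bigr do rewrite zE.
Qed.
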